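(* Let $n\ge2$, $\lambda\in\mathbb{R}$, and let $g=dx^2+\psi^2(x)g_{\mathbb{S}^n}$ be one of the singular gradient Ricci solitons obtained from solutions $(W,X,Y)$ emanating from $(0,1,0)$, as described in the context. Then the scalar curvature $R(g)$ satisfies $$\lim_{x\to0^+}R(g)=-\infty .$$
   Context: $g_{\mathbb{S}^n}$ is the canonical metric of the unit $n$-sphere. The solitons: $(W,X,Y)(y)$, $y\le0$, is a solution of $W'=W(X^2-\lambda W^2)$, $X'=X^3-X+\frac{Y^2}{\sqrt n}+\lambda(\sqrt n-X)W^2$, $Y'=Y(X^2-\frac X{\sqrt n}-\lambda W^2)$ with $W(0)>0$, $Y(0)>0$ and $(W,X,Y)(0)$ sufficiently close to the equilibrium $(0,1,0)$, so that $(W,X,Y)\to(0,1,0)$ as $y\to-\infty$; and $x=\int_{-\infty}^yW\,dy$, $\psi=\sqrt{n(n-1)}\,W/Y$, $\omega=(\sqrt nX-1)/W$. Then $g$ with potential $\phi$, $\dot\phi=\omega$, solves $\mathrm{Ric}(g)+\nabla\nabla\phi+\lambda g=0$ on $(0,\delta)\times\mathbb{S}^n$ for some $\delta>0$, with $\psi\sim a x^{1/\sqrt n}$, $a>0$, as $x\to0^+$. *)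

(* Defs.v *)
From mathcomp Require Export all_boot all_order all_algebra.
From mathcomp Require Export all_classical all_reals all_analysis.

Set Implicit Arguments.
Unset Strict Implicit.
Unset Printing Implicit Defensive.

Export Order.TTheory GRing.Theory Num.Theory.
Export numFieldNormedType.Exports.

Local Open Scope classical_set_scope.
Local Open Scope ring_scope.

(* A Riemannian metric in a chart is the matrix field p |-> (G_ij(p)).  As
   'D_v is total, the definitions below are meaningful only where G is smooth
   and invertible. *)
Section Curvature.
Context {R : realType} {m : nat}.
Implicit Types (G : 'rV[R]_m -> 'M[R]_m) (p : 'rV[R]_m) (i j k l : 'I_m).

Definition partial i (f : 'rV[R]_m -> R) p : R := 'D_(delta_mx 0 i) f p.

(* christoffel G k i j p is \Gamma^k_ij(p). *)
Definition christoffel G k i j p : R :=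
  2^-1 * \sum_l invmx (G p) k l *
    (partial i (fun q => G q j l) p + partial j (fun q => G q i l) p
     - partial l (fun q => G q i j) p).

(* riemann G l k i j p is the coefficient of d_l in
   (nabla_i nabla_j - nabla_j nabla_i) d_k. *)
Definition riemann G l k i j p : R :=
  partial i (christoffel G l j k) p - partial j (christoffel G l i k) p
  + \sum_s (christoffel G l i s p * christoffel G s j k p
            - christoffel G l j s p * christoffel G s i k p).

(* With these signs the unit n-sphere has Ric = (n - 1) g. *)
Definition ricci G j k p : R := \sum_i riemann G i k i j p.

Definition scalar_curvature G p : R :=
  \sum_j \sum_k invmx (G p) j k * ricci G j k p.

End Curvature.

Section Sphere.
Context {R : realType} {n : nat}.

(* Inverse of the stereographic projection of the unit n-sphere of R^(n+1) from
   the pole (0, ..., 0, 1) (south = false) or (0, ..., 0, -1) (south = true);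
   the two charts cover the sphere. *)
Definition stereo (south : bool) (u : 'rV[R]_n) : 'rV[R]_(n + 1) :=
  let r2 := \sum_i u 0 i ^+ 2 in
  row_mx ((2 / (1 + r2)) *: u) ((-1) ^+ south * (r2 - 1) / (1 + r2))%:M.

(* The canonical metric, induced by the Euclidean metric of R^(n+1). *)
Definition sphere_metric (south : bool) (u : 'rV[R]_n) : 'M[R]_n :=
  \matrix_(i, j) \sum_k
    partial i (fun v => stereo south v 0 k) u
    * partial j (fun v => stereo south v 0 k) u.

(* dx^2 + psi(x)^2 g_{S^n}, in the coordinates row_mx x%:M u. *)
Definition warped_metric (psi : R -> R) (south : bool) (p : 'rV[R]_(1 + n)) :
    'M[R]_(1 + n) :=
  block_mx 1%:M 0
           0 (psi (lsubmx p 0 0) ^+ 2 *: sphere_metric south (rsubmx p)).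

End Sphere.

Section Soliton.
Context {R : realType}.

(* The equations are two-sided for y < 0; continuity on y <= 0 yields the
   one-sided equations at y = 0.  For n >= 2 the equilibrium (0, 1, 0) is a
   source (eigenvalues 1, 2, 1 - 1 / sqrt n), so convergence of (W, X, Y) to it
   as y -> -oo follows from closeness of (W, X, Y)(0) and is not a field. *)
Record soliton_trajectory (n : nat) (lam : R) (W X Y : R -> R) : Prop := {
  trajectory_contW : {within `]-oo, 0], continuous W} ;
  trajectory_contX : {within `]-oo, 0], continuous X} ;
  trajectory_contY : {within `]-oo, 0], continuous Y} ;
  trajectory_W : forall y : R, y < 0 ->
    is_derive y 1 W (W y * (X y ^+ 2 - lam * W y ^+ 2)) ;
  trajectory_X : forall y : R, y < 0 ->
    is_derive y 1 X
      (X y ^+ 3 - X y + Y y ^+ 2 / Num.sqrt n%:R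
       + lam * (Num.sqrt n%:R - X y) * W y ^+ 2) ;
  trajectory_Y : forall y : R, y < 0 ->
    is_derive y 1 Y
      (Y y * (X y ^+ 2 - X y / Num.sqrt n%:R - lam * W y ^+ 2)) ;
  trajectory_W0 : 0 < W 0 ;
  trajectory_Y0 : 0 < Y 0
}.

(* x(y) *)
Definition arclength (W : R -> R) (y : R) : R :=
  (\int[lebesgue_measure]_(t in `]-oo, y]) W t)%R.

(* psi, omega and phi are functions of x; only their values on ]0, x(0)] are
   prescribed (phi up to a constant). *)
Record soliton_profile (n : nat) (W X Y psi omega phi : R -> R) : Prop := {
  profile_psi : forall y : R, y <= 0 ->
    psi (arclength W y) = Num.sqrt (n * (n - 1))%:R * W y / Y y ;
  profile_omega : forall y : R, y <= 0 ->
    omega (arclength W y) = (Num.sqrt n%:R * X y - 1) / W y ;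
  profile_phi : forall x : R, 0 < x < arclength W 0 ->
    is_derive x 1 phi (omega x)
}.

End Soliton.

(* Main.v *)
Require Import Defs.
From mathcomp Require Import measurable_realfun ring lra.

Set Implicit Arguments.
Unset Strict Implicit.
Unset Printing Implicit Defensive.

Local Open Scope classical_set_scope.
Local Open Scope ring_scope.

(** Write r for sqrt n.  Along a trajectory, the arclength x satisfies
   dx/dy = W, and psi'/psi = X / (r W) (derivatives of psi are in x), because
   (log W)_y - (log Y)_y = X / r.  Differentiating once more and inserting the
   result in the scalar curvature of a warped product over the unit n-sphere,
   [scalar_curvature_warped],
     R = n (n - 1) (1 - psi'^2) / psi^2 - 2 n psi'' / psi,
   gives ([soliton_scalar_curvature])
     R = (2 r X - (n + 1) X^2 - Y^2 - 2 n lam W^2) / W^2.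
   At X = 1 the leading part of the numerator is -(r - 1)^2 < 0, and it stays
   below -1/10 when X is close to 1 ([ball_curvature]).  Hence R tends to
   -oo as soon as X stays close to 1 and W tends to 0 as y -> -oo.

   Both facts come from V = (X - 1)^2 + W^2 + Y^2, which is nondecreasing in y on
   a small ball around the equilibrium (0, 1, 0) ([ball_lyapunov]); so a
   trajectory that starts in the ball stays in it for all y <= 0 ([trapped]).
   There W'/W >= 1/2, whence W(y) <= W(0) e^(y/2) ([linear_ode_decay]).  This
   makes W integrable, sends the arclength to 0 as y -> -oo, and thus lets every
   small x > 0 be written as x(y) with y very negative ([arclength_surj]).

   The curvature of the warped product is computed in the stereographic
   coordinates, where the metric is diagonal: diag(1, (psi s)^2, ..., (psi s)^2)
   with the conformal factor s = 2 / (1 + |u|^2).  Its Christoffel symbols are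
   explicit ([christoffel_warped]), and only the diagonal Ricci coefficients
   ([ricci_radial], [ricci_angular]) enter the trace. *)

(** * Directional derivatives *)

Section DirectionalCalculus.
Context {R : realType} {V : normedModType R}.
Implicit Types (f : V -> R) (p v : V) (d : R).

(** A directional derivative only sees the restriction of the function to a
   line, which reduces chain rules to the one-variable case. *)
Lemma is_derive_lineP f p v d :
  is_derive p v f d <-> is_derive (0 : R) 1 (fun h => f (h *: v + p)) d.
Proof.
have E : (fun h : R => h^-1 *: ((f \o shift p) (h *: v) - f p)) =
    (fun h : R => h^-1 *:
       (((fun h => f (h *: v + p)) \o shift 0) (h *: (1 : R)) - f (0 *: v + p))).
  apply/funext => h /=.
  by rewrite (_ : h *: 1 = h) ?addr0 ?scale0r ?add0r// /GRing.scale/= mulr1.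
by split=> -[H1 H2]; split; move: H1 H2; rewrite /derivable /derive E.
Qed.

Lemma is_derive_comp1 (g : R -> R) f p v a b :
  is_derive (f p) 1 g a -> is_derive p v f b ->
  is_derive p v (fun q => g (f q)) (a * b).
Proof.
move=> Hg /is_derive_lineP Hf; apply/is_derive_lineP.
by apply: (@is_derive1_comp _ g) => //; rewrite scale0r add0r.
Qed.
End DirectionalCalculus.

Lemma is_derive_coord {R : realType} (m k : nat) (p v : 'M[R]_(m, k)) i j :
  is_derive p v (fun q => q i j) (v i j).
Proof.
apply/is_derive_lineP.
rewrite (_ : (fun _ => _) = (fun h : R => h * v i j + p i j)); last first.
  by apply/funext => h; rewrite !mxE.
by apply: is_derive_eq; rewrite /GRing.scale/=; ring.
Qed.

(** * Diagonal metrics *)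

Section DiagonalMetric.
Context {R : realType} {m : nat}.
Implicit Types (p : 'rV[R]_m) (i j k : 'I_m).

Lemma invmx_diag (d : 'rV[R]_m) : (forall k, d 0 k != 0) ->
  invmx (diag_mx d) = diag_mx (\row_k (d 0 k)^-1).
Proof.
move=> d0; have H : diag_mx d *m diag_mx (\row_k (d 0 k)^-1) = 1%:M.
  rewrite mulmx_diag -diag_const_mx; congr diag_mx.
  by apply/rowP => k; rewrite !mxE divff.
have [U _] := mulmx1_unit H.
by apply: (can_inj (mulKmx U)); rewrite H mulmxV.
Qed.

Lemma sum_delta (k : 'I_m) (F : 'I_m -> R) :
  \sum_l (k == l)%:R * F l = F k.
Proof.
rewrite (bigD1 k)//= eqxx mul1r big1 ?addr0// => l /negbTE.
by rewrite eq_sym => ->; rewrite mul0r.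
Qed.

Lemma partial_mulrb (b : bool) i (h : 'rV[R]_m -> R) p d :
  is_derive p (delta_mx 0 i) h d ->
  partial i (fun q => h q *+ b) p = d *+ b.
Proof.
case: b => H; rewrite /partial/=; last exact: derive_cst.
by rewrite mulr1n; apply: derive_val.
Qed.

Lemma christoffel_diag (h : 'I_m -> 'rV[R]_m -> R) (dh : 'I_m -> 'I_m -> R) p k i j :
  (forall k, h k p != 0) ->
  (forall k i, is_derive p (delta_mx 0 i) (h k) (dh k i)) ->
  christoffel (fun q => diag_mx (\row_k h k q)) k i j p =
  2^-1 * (h k p)^-1 *
    (dh k i *+ (k == j) + dh k j *+ (k == i) - dh i k *+ (i == j)).
Proof.
move=> h0 H; rewrite /christoffel invmx_diag; last by move=> l; rewrite mxE.
have E a b c : partial c (fun q => diag_mx (\row_k h k q) a b) p = dh a c *+ (a == b).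
  rewrite -(partial_mulrb (a == b) (H a c)); congr partial.
  by apply/funext => q; rewrite !mxE; case: eqP => // ->.
under eq_bigr => l _ do rewrite /= !E !mxE -mulr_natl -mulrA.
rewrite sum_delta mulrA; congr (_ * (_ + _ - _)).
- by case: (eqVneq k j) => // ->; rewrite ?eqxx.
- by case: (eqVneq k i) => // ->; rewrite ?eqxx.
Qed.

Lemma scalar_curvature_diag (h : 'I_m -> 'rV[R]_m -> R) p :
  (forall k, h k p != 0) ->
  scalar_curvature (fun q => diag_mx (\row_k h k q)) p =
  \sum_j (h j p)^-1 * ricci (fun q => diag_mx (\row_k h k q)) j j p.
Proof.
move=> h0; rewrite /scalar_curvature invmx_diag; last by move=> l; rewrite mxE.
apply: eq_bigr => j _; under eq_bigr => l _ do rewrite !mxE -mulr_natl -mulrA.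
by rewrite sum_delta.
Qed.
End DiagonalMetric.

(** * The round sphere in stereographic coordinates *)

Section RoundSphere.
Context {R : realType} {n : nat}.
Implicit Types (u v : 'rV[R]_n).

Definition sqnorm u : R := \sum_i u 0 i ^+ 2.

(** The conformal factor: the round metric is [conf u ^+ 2] times the Euclidean
   one. *)
Definition conf u : R := 2 / (1 + sqnorm u).

Lemma sqnorm1_gt0 u : 0 < 1 + sqnorm u.
Proof. by rewrite ltr_pwDl// sumr_ge0// => i _; rewrite sqr_ge0. Qed.

Lemma conf_gt0 u : 0 < conf u.
Proof. by rewrite divr_gt0// sqnorm1_gt0. Qed.

(** Eliminates [sqnorm u], so that the identities between coefficients below become
   polynomial in the conformal factor and the coordinates. *)
Lemma conf_sqnorm u : conf u * sqnorm u = 2 - conf u.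
Proof.
by rewrite /conf; have := lt0r_neq0 (sqnorm1_gt0 u); move=> ?; field.
Qed.

Lemma is_derive_conf u v :
  is_derive u v conf (- conf u ^+ 2 * \sum_i u 0 i * v 0 i).
Proof.
have Hs : is_derive u v sqnorm (\sum_i 2 * u 0 i * v 0 i).
  rewrite /sqnorm.
  have -> : (fun u => \sum_i u 0 i ^+ 2) =
      \sum_(i < n) (fun u : 'rV[R]_n => u 0 i ^+ 2).
    by apply/funext => w; rewrite fct_sumE.
  apply: is_derive_sum => i.
  have := is_derive_coord u v 0 i => Hc.
  by apply: is_derive_eq; rewrite /GRing.scale/=; ring.
have s0 := lt0r_neq0 (sqnorm1_gt0 u).
have Hg : is_derive (sqnorm u) 1 (fun s : R => 2 / (1 + s)) (- conf u ^+ 2 / 2).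
  have H1 : is_derive (sqnorm u) 1 (fun s : R => 1 + s) 1.
    by apply: is_derive_eq; rewrite ?add0r ?mulr1.
  have H2 := is_deriveV s0 H1.
  have H3 := is_deriveZ 2 H2.
  by apply: is_derive_eq; rewrite /conf /GRing.scale/=; field.
have H : is_derive u v conf _ := is_derive_comp1 Hg Hs.
apply: is_derive_eq.
by rewrite !mulr_sumr; apply: eq_bigr => i _; field.
Qed.

(** The tangential and last coordinates of [stereo] contribute terms in u_i u_j that
   cancel by [conf_sqnorm].  The choice of the pole is a sign in the last coordinate,
   whose derivative enters squared. *)
Lemma sphere_metricE (south : bool) u i j :
  sphere_metric south u i j = conf u ^+ 2 *+ (i == j).
Proof.
have dconf k : is_derive u (delta_mx 0 k) conf (- conf u ^+ 2 * u 0 k).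
  apply: is_derive_eq; first exact: is_derive_conf.
  congr (_ * _); rewrite -[RHS](sum_delta k (fun l => u 0 l)).
  by apply: eq_bigr => l _; rewrite mxE eqxx mulrC eq_sym.
have dlow k l : partial k (fun v => stereo south v 0 (lshift 1 l)) u =
    - conf u ^+ 2 * u 0 k * u 0 l + conf u * (k == l)%:R.
  rewrite /partial.
  have -> : (fun v : 'rV[R]_n => stereo south v 0 (lshift 1 l)) =
      (fun v => conf v * v 0 l).
    by apply/funext => v; rewrite /stereo row_mxEl mxE.
  have Hc := is_derive_coord u (delta_mx 0 k) 0 l.
  have Hm := is_deriveM (dconf k) Hc.
  by rewrite derive_val /GRing.scale/= mxE eqxx/= eq_sym; ring.
have dhigh k : partial k (fun v => stereo south v 0 (rshift n ord0)) u =
    (-1) ^+ south * conf u ^+ 2 * u 0 k.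
  rewrite /partial.
  have -> : (fun v : 'rV[R]_n => stereo south v 0 (rshift n ord0)) =
      (fun v => (-1) ^+ south * (1 - conf v)).
    apply/funext => v; rewrite /stereo row_mxEr mxE eqxx mulr1n -mulrA; congr (_ * _).
    rewrite /conf /sqnorm; have := lt0r_neq0 (sqnorm1_gt0 v); rewrite /sqnorm => ?; field.
    by [].
  have H := dconf k.
  by rewrite derive_val /GRing.scale/=; ring.
rewrite mxE big_split_ord/= big_ord1 !dhigh.
under eq_bigr => l _ do rewrite !dlow.
under eq_bigr => l _.
  rewrite (_ : _ * _ = conf u ^+ 4 * u 0 i * u 0 j * u 0 l ^+ 2
     + (i == l)%:R * (- conf u ^+ 3 * u 0 j * u 0 l + conf u ^+ 2 * (j == l)%:R)
     + (j == l)%:R * (- conf u ^+ 3 * u 0 i * u 0 l)); last by ring.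
  over.
rewrite !big_split/= -mulr_sumr !sum_delta -/(sqnorm u).
have -> : conf u ^+ 4 * u 0 i * u 0 j * sqnorm u =
    conf u ^+ 3 * u 0 i * u 0 j * (conf u * sqnorm u).
  by ring.
rewrite conf_sqnorm -mulr_natr eq_sym.
have -> : (-1) ^+ south * conf u ^+ 2 * u 0 i * ((-1) ^+ south * conf u ^+ 2 * u 0 j) =
   ((-1) ^+ south * (-1) ^+ south) * conf u ^+ 4 * u 0 i * u 0 j by ring.
by rewrite -expr2 sqrr_sign; ring.
Qed.

End RoundSphere.

(** * Curvature of a warped product over the sphere *)

Section WarpedProduct.
Context {R : realType} {n : nat}.
Variables (psi psi1 : R -> R) (south : bool).
Implicit Types (q : 'rV[R]_(1 + n)) (i j k : 'I_(1 + n)) (a b c : 'I_n).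

Notation radial := (lshift n (@ord0 0)).
Notation angular := (rshift 1).
Notation G := (warped_metric psi south).

Lemma split_radial (z : 'I_1) : fintype.split (lshift n z) = inl z.
Proof. exact: (unsplitK (inl z)). Qed.

Lemma split_angular a : fintype.split (rshift 1 a) = inr a.
Proof. exact: (unsplitK (inr a)). Qed.

Definition warped_entry k q : R :=
  if fintype.split k is inr _ then (psi (q 0 radial) * conf (rsubmx q)) ^+ 2 else 1.

Lemma warped_metricE : G = fun q => diag_mx (\row_k warped_entry k q).
Proof.
apply/funext => q; apply/matrixP => i j; rewrite [RHS]mxE [in RHS]mxE /warped_entry.
case: (split_ordP i) => z ->; case: (split_ordP j) => w ->;
  rewrite ?split_radial ?split_angular ?eq_lrshift ?eq_rlshift ?eq_lshift ?eq_rshift.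
- by rewrite block_mxEul mxE.
- by rewrite block_mxEur mxE.
- by rewrite block_mxEdl mxE.
by rewrite block_mxEdr mxE sphere_metricE !mxE [in RHS]exprMn mulrnAr.
Qed.

(** The upper index is [k].  The radial direction contributes the logarithmic
   derivative of [psi]; the purely angular symbols are those of the conformally
   flat metric of factor s, for which d_a log s = - s u_a. *)
Definition warped_Gamma k i j q : R :=
  let s := conf (rsubmx q) in let x := q 0 radial in
  match fintype.split k, fintype.split i, fintype.split j with
  | inl _, inr a, inr b => - (psi x * psi1 x * s ^+ 2) *+ (a == b)
  | inr a, inl _, inr b | inr a, inr b, inl _ => (psi1 x / psi x) *+ (a == b)
  | inr a, inr b, inr c =>
      s * (rsubmx q 0 a *+ (b == c) - rsubmx q 0 b *+ (a == c)
           - rsubmx q 0 c *+ (a == b))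
  | _, _, _ => 0
  end.

Lemma is_derive_radial (f : R -> R) d q i : is_derive (q 0 radial) 1 f d ->
  is_derive q (delta_mx 0 i) (fun q => f (q 0 radial)) (d *+ (radial == i)).
Proof.
move=> Hf; have Hc := is_derive_coord q (delta_mx 0 i) 0 radial.
apply: is_derive_eq; first exact: is_derive_comp1 Hf Hc.
by rewrite mxE eqxx/= mulr_natr.
Qed.

Lemma is_derive_rsubmx (f : 'rV[R]_n -> R) d q v :
  is_derive (rsubmx q) (rsubmx v) f d -> is_derive q v (fun q => f (rsubmx q)) d.
Proof.
move/is_derive_lineP => H; apply/is_derive_lineP.
by under eq_fun do rewrite linearD linearZ.
Qed.

Lemma rsubmx_radial : rsubmx (delta_mx 0 radial : 'rV[R]_(1 + n)) = 0.
Proof. by apply/rowP => a; rewrite !mxE eq_rlshift andbF. Qed.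

Lemma rsubmx_angular b :
  rsubmx (delta_mx 0 (angular b) : 'rV[R]_(1 + n)) = delta_mx 0 b.
Proof. by apply/rowP => a; rewrite !mxE eq_rshift. Qed.

Lemma is_derive_conf_radial q :
  is_derive q (delta_mx 0 radial) (fun q => conf (rsubmx q)) 0.
Proof.
by apply: is_derive_rsubmx; rewrite rsubmx_radial; exact: is_derive0.
Qed.

Lemma is_derive_conf_angular q b :
  is_derive q (delta_mx 0 (angular b)) (fun q => conf (rsubmx q))
    (- conf (rsubmx q) ^+ 2 * rsubmx q 0 b).
Proof.
apply: is_derive_rsubmx; rewrite rsubmx_angular.
apply: is_derive_eq; first exact: is_derive_conf.
congr (_ * _); rewrite -[RHS](sum_delta b (fun l => rsubmx q 0 l)).
by apply: eq_bigr => l _; rewrite [delta_mx _ _ _ _]mxE eqxx mulrC eq_sym.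
Qed.

Lemma is_derive_coord_angular q a b :
  is_derive q (delta_mx 0 (angular a)) (fun q => rsubmx q 0 b) (b == a)%:R.
Proof.
apply: (@is_derive_rsubmx (fun u => u 0 b)); rewrite rsubmx_angular.
apply: is_derive_eq; first exact: is_derive_coord.
by rewrite mxE eqxx.
Qed.

Lemma christoffel_warped k i j q :
  is_derive (q 0 radial) 1 psi (psi1 (q 0 radial)) -> psi (q 0 radial) != 0 ->
  christoffel G k i j q = warped_Gamma k i j q.
Proof.
move=> Hpsi psi0; set x := q 0 radial; set s := conf (rsubmx q).
have s0 : s != 0 by rewrite lt0r_neq0// conf_gt0.
pose dh k i := if fintype.split k is inr _ then
  2 * (psi x * s) * (match fintype.split i with inl _ => psi1 x * s
    | inr b => psi x * (- s ^+ 2 * rsubmx q 0 b) end) else 0.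
have h0 l : warped_entry l q != 0.
  by rewrite /warped_entry; case: fintype.split => // _; rewrite expf_neq0// mulf_neq0.
have Hd l m : is_derive q (delta_mx 0 m) (warped_entry l) (dh l m).
  rewrite /warped_entry /dh; case: fintype.split => _; first exact: is_derive_cst.
  have Hr := is_derive_radial m Hpsi.
  case: (split_ordP m) Hr => [z ->|b ->] Hr; rewrite ?split_radial ?split_angular.
    rewrite ord1 in Hr *.
    have Hc := is_derive_conf_radial q.
    have Hm := is_deriveM Hr Hc.
    by apply: is_derive_eq; rewrite /GRing.scale/= /x /s; ring.
  have Hc := is_derive_conf_angular q b.
  have Hm := is_deriveM Hr Hc.
  by apply: is_derive_eq; rewrite /GRing.scale/= /x /s; ring.
rewrite warped_metricE (christoffel_diag k i j h0 Hd).
rewrite /warped_entry /dh /warped_Gamma -/x -/s.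
clear h0 Hd dh Hpsi.
(* Eight blocks of indices; in each, one case per coincidence of angular indices. *)
case: (split_ordP k) => z ->; case: (split_ordP i) => w ->; case: (split_ordP j) => t ->;
  rewrite ?split_radial ?split_angular ?eq_lrshift ?eq_rlshift ?eq_lshift ?eq_rshift.
all: move: (psi x) (psi1 x) psi0 => P P1 P0; move: s s0 => S S0; clear x.
all: move: (rsubmx q 0) => u; rewrite !mulrb; repeat (case: ifP => // _).
all: field; rewrite ?P0 ?S0//.
Qed.

Notation Gamma := warped_Gamma.

Variables (p : 'rV[R]_(1 + n)) (psi2 : R).
Notation x := (p 0 radial : R).
Notation s := (conf (rsubmx p)).
Notation u a := (rsubmx p 0 a).

Hypothesis dpsi : \forall y \near x, is_derive (y : R) 1 psi (psi1 y).
Hypothesis psi_neq0 : \forall y \near x, psi y != 0.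
Hypothesis dpsi1 : is_derive x 1 psi1 psi2.

(** The explicit symbols may be differentiated in place of the Christoffel
   symbols because the two agree near [p], and not only at [p]. *)
Lemma ricci_warped j k : ricci G j k p =
  \sum_i (partial i (Gamma i j k) p - partial j (Gamma i i k) p
    + \sum_s (Gamma i i s p * Gamma s j k p - Gamma i j s p * Gamma s i k p)).
Proof.
have near_Gamma (a b c : 'I_(1 + n)) :
    \forall q \near p, christoffel G a b c q = Gamma a b c q.
  have cp : (fun q : 'rV[R]_(1 + n) => q 0 radial) @ p --> x by exact: coord_continuous.
  have H1 := cp _ dpsi; have H2 := cp _ psi_neq0.
  near=> q; apply: christoffel_warped.
    by near: q.
  by near: q.
have atp (a b c : 'I_(1 + n)) :
  christoffel G a b c p = Gamma a b c p by exact: (nbhs_singleton (near_Gamma a b c)).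
apply: eq_bigr => i _; rewrite /riemann; congr (_ - _ + _).
- exact: near_eq_derive.
- exact: near_eq_derive.
by apply: eq_bigr => t _; rewrite !atp.
Unshelve. all: by end_near. Qed.

Let psi_x_neq0 : psi x != 0. Proof. exact: nbhs_singleton psi_neq0. Qed.
Let dpsi_x : is_derive x 1 psi (psi1 x). Proof. exact: (nbhs_singleton dpsi). Qed.

Lemma partial_radial_mixed b :
  partial radial (Gamma (angular b) (angular b) radial) p =
  psi2 / psi x - (psi1 x / psi x) ^+ 2.
Proof.
rewrite /partial.
have -> : Gamma (angular b) (angular b) radial =
    fun q => psi1 (q 0 radial) / psi (q 0 radial).
  by apply/funext => q; rewrite /warped_Gamma !split_angular split_radial eqxx mulr1n.
have H := is_derive_radial radial (is_deriveM dpsi1 (is_deriveV psi_x_neq0 dpsi_x)).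
rewrite derive_val /GRing.scale/=.
by field.
Qed.

Lemma partial_radial_normal a :
  partial radial (Gamma radial (angular a) (angular a)) p =
  - (psi1 x ^+ 2 + psi x * psi2) * s ^+ 2.
Proof.
rewrite /partial.
have -> : Gamma radial (angular a) (angular a) =
    (fun q => (- (psi (q 0 radial) * psi1 (q 0 radial))) * conf (rsubmx q) ^+ 2).
  by apply/funext => q; rewrite /warped_Gamma !split_angular split_radial eqxx mulr1n mulNr.
have H := is_derive_radial radial (is_deriveN (is_deriveM dpsi_x dpsi1)).
have H1 := is_derive_conf_radial p.
rewrite derive_val /GRing.scale/=.
by ring.
Qed.

Lemma partial_angular_trace a b :
  partial (angular a) (Gamma (angular b) (angular b) (angular a)) p =
  s ^+ 2 * u a ^+ 2 - s.
Proof.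
rewrite /partial.
have -> : Gamma (angular b) (angular b) (angular a) =
    (fun q => - (conf (rsubmx q) * rsubmx q 0 a)).
  apply/funext => q; rewrite /warped_Gamma !split_angular eqxx mulr1n.
  by case: eqVneq => [->|_]; rewrite ?mulr1n ?mulr0n; ring.
have Hc := is_derive_conf_angular p a.
have Hu := is_derive_coord_angular p a a.
rewrite derive_val /GRing.scale/= eqxx mulr1n.
by ring.
Qed.

Lemma partial_angular_diag a b :
  partial (angular b) (Gamma (angular b) (angular a) (angular a)) p =
  s * (1 - 2 * (a == b)%:R) - s ^+ 2 * u b * (u b - 2 * (a == b)%:R * u a).
Proof.
rewrite /partial.
have -> : Gamma (angular b) (angular a) (angular a) =
    (fun q => conf (rsubmx q) * (rsubmx q 0 b - 2 * (a == b)%:R * rsubmx q 0 a)).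
  apply/funext => q; rewrite /warped_Gamma !split_angular eqxx mulr1n eq_sym.
  by case: eqVneq => [->|_]; rewrite ?mulr1n ?mulr0n; ring.
have Hc := is_derive_conf_angular p b.
have Hu := is_derive_coord_angular p b b.
have Hv := is_derive_coord_angular p b a.
have Hw := is_deriveM Hc (is_deriveB Hu (is_deriveZ (2 * (a == b)%:R) Hv)).
rewrite derive_val /GRing.scale/= eqxx mulr1n.
by rewrite !fctE/=; case: eqVneq => [->|_]; rewrite ?mulr1n ?mulr0n /GRing.scale/=; ring.
Qed.

Lemma partial_Gamma0 i (a b c : 'I_(1 + n)) :
  Gamma a b c = (fun=> 0) -> partial i (Gamma a b c) p = 0.
Proof. by move=> ->; exact: derive_cst. Qed.

Lemma ricci_radial : ricci G radial radial p = - n%:R * (psi2 / psi x).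
Proof.
rewrite ricci_warped big_split_ord/= big_ord1.
have E : forall q, Gamma radial radial radial q = 0.
  by move=> q; rewrite /warped_Gamma ?(split_radial, split_angular).
have E1 b : forall q, Gamma (angular b) radial radial q = 0.
  by move=> q; rewrite /warped_Gamma ?(split_radial, split_angular).
have E2 b : forall q, Gamma radial radial (angular b) q = 0.
  by move=> q; rewrite /warped_Gamma ?(split_radial, split_angular).
have E3 b : forall q, Gamma radial (angular b) radial q = 0.
  by move=> q; rewrite /warped_Gamma ?(split_radial, split_angular).
have P0 : partial radial (Gamma radial radial radial) p = 0.
  by apply: partial_Gamma0; apply/funext => q; exact: E.
rewrite P0 big_split_ord/= big_ord1 E big1 => [|b _]; last by rewrite E1 E2; ring.
rewrite (eq_bigr (fun=> - (psi2 / psi x))) => [|b _].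
  by rewrite sumr_const card_ord -mulr_natl; ring.
rewrite partial_radial_mixed (partial_Gamma0 _ (funext (E1 b))).
rewrite big_split_ord/= big_ord1 E E1 E3.
rewrite (eq_bigr (fun c => (b == c)%:R * - (psi1 x / psi x) ^+ 2)).
  by rewrite sum_delta; ring.
move=> c _; rewrite E1 /warped_Gamma ?(split_radial, split_angular) [c == b]eq_sym.
by case: (b == c); rewrite ?mulr1n ?mulr0n; ring.
Qed.

(** The shape in which every sum over angular indices below is put: a constant, a
   multiple of the squared coordinate, and two Kronecker terms. *)
Lemma sum_sqr_delta (A B C D : R) a b :
  \sum_c (A + B * u c ^+ 2 + (a == c)%:R * C + (b == c)%:R * D) =
  n%:R * A + B * sqnorm (rsubmx p) + C + D.
Proof.
rewrite !big_split/= -mulr_sumr (sum_delta a (fun=> C)) (sum_delta b (fun=> D)).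
by rewrite sumr_const card_ord mulr_natl.
Qed.

(** After summation the coefficient of u_a^2 cancels, and [conf_sqnorm] turns
   s^2 |u|^2 into 2 s - s^2, which leaves the (n - 1) s^2 of the unit sphere and
   the radial contribution. *)
Lemma ricci_angular a : ricci G (angular a) (angular a) p =
  s ^+ 2 * ((n%:R - 1) * (1 - psi1 x ^+ 2) - psi x * psi2).
Proof.
pose H := psi1 x / psi x; pose K := psi x * psi1 x.
have HK : H * K = psi1 x ^+ 2 by rewrite /H /K; field.
have Krr b c : Gamma radial (angular b) (angular c) p = - (K * s ^+ 2) * (b == c)%:R.
  by rewrite /warped_Gamma ?(split_radial, split_angular) mulr_natr.
have Hl b c : Gamma (angular b) radial (angular c) p = H * (b == c)%:R.
  by rewrite /warped_Gamma ?(split_radial, split_angular) mulr_natr.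
have Hr b c : Gamma (angular b) (angular c) radial p = H * (b == c)%:R.
  by rewrite /warped_Gamma ?(split_radial, split_angular) mulr_natr.
have Ang b c d : Gamma (angular b) (angular c) (angular d) p =
    s * (u b * (c == d)%:R - u c * (b == d)%:R - u d * (b == c)%:R).
  by rewrite /warped_Gamma ?(split_radial, split_angular) !mulr_natr.
have E b : forall q, Gamma radial (angular b) radial q = 0.
  by move=> q; rewrite /warped_Gamma ?(split_radial, split_angular).
have E' (b : 'I_(1 + n)) : forall q, Gamma radial radial b q = 0.
  by move=> q; rewrite /warped_Gamma ?(split_radial, split_angular).
rewrite ricci_warped big_split_ord/= big_ord1.
rewrite partial_radial_normal (partial_Gamma0 _ (funext (E' _))).
rewrite big_split_ord/= big_ord1 !E' E.
rewrite (eq_bigr (fun b => 0 + 0 * u b ^+ 2 + (a == b)%:R * (psi1 x ^+ 2 * s ^+ 2)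
   + (a == b)%:R * 0)); last first.
  move=> b _; rewrite E' Krr Hl [b == a]eq_sym -HK.
  by case: (a == b); rewrite ?mulr1n ?mulr0n; ring.
rewrite sum_sqr_delta.
(* With d the Kronecker symbol, the product of the two symbols at fixed c is
   s^2 (d_bc u_a^2 - (d_ab u_c - d_ac u_b)^2). *)
have in_b b : \sum_(c < n)
    (Gamma (angular b) (angular b) (angular c) p
       * Gamma (angular c) (angular a) (angular a) p
     - Gamma (angular b) (angular a) (angular c) p
       * Gamma (angular c) (angular b) (angular a) p) =
   s ^+ 2 * (((a == b)%:R - 1) * sqnorm (rsubmx p) +
     (2 * u a ^+ 2 - 2 * (a == b)%:R * u a ^+ 2 + u b ^+ 2) - u a ^+ 2).
  rewrite (eq_bigr (fun c => 0 + s ^+ 2 * ((a == b)%:R - 1) * u c ^+ 2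
     + (a == c)%:R * (s ^+ 2 * (2 * u a ^+ 2 - 2 * (a == b)%:R * u a ^+ 2 + u b ^+ 2))
     + (b == c)%:R * (- s ^+ 2 * u a ^+ 2))).
    by rewrite sum_sqr_delta; ring.
  move=> c _; rewrite !Ang !eqxx [b == a]eq_sym [c == a]eq_sym [c == b]eq_sym.
  case: (eqVneq a b) => [->|ab]; case: (eqVneq b c) => [<-|bc]; rewrite ?eqxx ?mulr1n ?mulr0n; try ring.
    by rewrite (negbTE ab) mulr0n; ring.
  by case: (eqVneq a c) => [->|ac]; rewrite ?eqxx ?mulr1n ?mulr0n; try ring.
rewrite (eq_bigr (fun b => (2 * s - psi1 x ^+ 2 * s ^+ 2 - s ^+ 2 * sqnorm (rsubmx p))
   + 0 * u b ^+ 2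
   + (a == b)%:R * (psi1 x ^+ 2 * s ^+ 2 + s ^+ 2 * sqnorm (rsubmx p) - 2 * s)
   + (a == b)%:R * 0)); last first.
  move=> b _.
  rewrite partial_angular_diag partial_angular_trace big_split_ord/= big_ord1.
  rewrite in_b !Hr !Krr !eqxx [b == a]eq_sym -HK.
  by case: (eqVneq a b) => [->|ab]; rewrite ?mulr1n ?mulr0n; ring.
rewrite sum_sqr_delta.
have -> : sqnorm (rsubmx p) = (2 - s) / s.
  by rewrite -conf_sqnorm mulrC mulKf// lt0r_neq0// conf_gt0.
have s0 : s != 0 by rewrite lt0r_neq0// conf_gt0.
by field.
Qed.

Lemma scalar_curvature_warped :
  scalar_curvature G p =
  n%:R * ((n%:R - 1) * (1 - psi1 x ^+ 2) / psi x ^+ 2 - 2 * (psi2 / psi x)).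
Proof.
have s0 : s != 0 by rewrite lt0r_neq0// conf_gt0.
rewrite warped_metricE scalar_curvature_diag; last first.
  move=> k; rewrite /warped_entry; case: fintype.split => // _.
  by rewrite expf_neq0// mulf_neq0.
rewrite -warped_metricE big_split_ord/= big_ord1 ricci_radial.
rewrite /warped_entry split_radial.
under eq_bigr => a _ do rewrite ricci_angular split_angular.
rewrite sumr_const card_ord -mulr_natl.
by field; rewrite s0 psi_x_neq0.
Qed.
End WarpedProduct.

(** * Linear differential inequalities on the negative half-line *)

Section LinearODE.
Context {R : realType}.
Implicit Types (f a : R -> R).

Lemma is_derive_ge0_ndecrNy f df (b : R) :
  (forall y : R, y < b -> is_derive y 1 f (df y)) ->
  (forall y : R, y < b -> 0 <= df y) ->
  {within `]-oo, b], continuous f} ->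
  forall y z : R, y <= z -> z <= b -> f y <= f z.
Proof.
move=> Hd H0 Hc; apply: ger0_derive1_ndecrNy Hc.
  by move=> y; rewrite in_itv/= => yb; have := Hd _ yb => -[].
move=> y; rewrite in_itv/= => yb; have H := Hd _ yb.
by rewrite derive1E derive_val; exact: H0.
Qed.

Lemma within_continuousM (A : set R) f g :
  {within A, continuous f} -> {within A, continuous g} ->
  {within A, continuous (f \* g)}.
Proof. by move=> cf cg y; apply: continuousM; [exact: cf|exact: cg]. Qed.

Lemma within_continuousN (A : set R) f :
  {within A, continuous f} -> {within A, continuous (fun y => - f y)}.
Proof. by move=> cf y; apply: continuousN; exact: cf. Qed.

Lemma continuous_mul_expR f (c : R) :
  {within `]-oo, 0], continuous f} ->
  {within `]-oo, 0], continuous (fun y => f y * expR (c * y))}.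
Proof.
move=> cf; apply: within_continuousM => //.
apply: continuous_subspaceT => y.
apply: (@continuous_comp _ _ _ ( *%R c) expR); first exact: mulrl_continuous.
exact: continuous_expR.
Qed.

Lemma is_derive_mul_expR f (c y d : R) : is_derive y 1 f d ->
  is_derive y 1 (fun y => f y * expR (c * y)) ((d + c * f y) * expR (c * y)).
Proof.
move=> Hf.
have H1 : is_derive y 1 ( *%R c) c.
  by apply: is_derive_eq; rewrite /GRing.scale/= mulr1.
have H2 := is_derive1_comp (is_derive_expR (c * y)) H1.
have H3 := is_deriveM Hf H2.
by apply: is_derive_eq; rewrite /GRing.scale/=; ring.
Qed.

(** f^2 e^(-2 M y) is nonincreasing, so f, positive at 0, cannot have vanished
   before. *)
Lemma linear_ode_gt0 f a (M : R) :
  {within `]-oo, 0], continuous f} ->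
  (forall y : R, y < 0 -> is_derive y 1 f (f y * a y)) ->
  (forall y : R, y < 0 -> a y <= M) ->
  0 < f 0 -> forall y : R, y <= 0 -> 0 < f y.
Proof.
move=> cf df aM f0 y y0.
have neq0 (z : R) : z <= 0 -> f z != 0.
  move=> z0; apply: contra_ltN f0 => /eqP fz.
  pose g y := - (f y ^+ 2 * expR (- (2 * M) * y)).
  have dg (w : R) : w < 0 -> is_derive w 1 g
      (f w ^+ 2 * (2 * (M - a w)) * expR (- (2 * M) * w)).
    move=> w0; have Hf := df _ w0.
    have H1 := is_deriveX 2 Hf.
    have H2 := is_deriveN (is_derive_mul_expR (- (2 * M)) H1).
    apply: (is_derive_eq H2).
    by rewrite !fctE/= /GRing.scale/=; ring.
  have cg : {within `]-oo, 0], continuous g}.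
    apply: within_continuousN; apply: continuous_mul_expR.
    exact: within_continuousM.
  have := @is_derive_ge0_ndecrNy g _ 0 dg _ cg z 0 z0 (lexx 0).
  rewrite /g fz mulr0 expR0 mulr1 expr0n/= mul0r oppr0 oppr_ge0 => H.
  have {}H : f 0 ^+ 2 <= 0.
    apply: H => w w0; apply: mulr_ge0 (expR_ge0 _).
    by apply: mulr_ge0 (sqr_ge0 _) _; rewrite mulr_ge0// subr_ge0 aM.
  have := sqr_ge0 (f 0) => ?; have /eqP : f 0 ^+ 2 == 0 by rewrite eq_le H.
  by move/eqP; rewrite sqrf_eq0 => /eqP ->.
have [//|fy] := ltP 0 (f y).
have cyf : {within `[y, 0], continuous f}.
  by apply: continuous_subspaceW cf; exact: subset_itvr.
have [|c + /eqP fc] := IVT y0 cyf (v := 0).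
  by rewrite ge_min le_max fy (ltW f0) orbT.
rewrite in_itv/= => /andP[_ c0].
by rewrite (negPf (neq0 _ c0)) in fc.
Qed.

(** f e^(- m y) is nondecreasing. *)
Lemma linear_ode_decay f a (m : R) :
  {within `]-oo, 0], continuous f} ->
  (forall y : R, y < 0 -> is_derive y 1 f (f y * a y)) ->
  (forall y : R, y < 0 -> m <= a y) -> (forall y : R, y <= 0 -> 0 < f y) ->
  forall y : R, y <= 0 -> f y <= f 0 * expR (m * y).
Proof.
move=> cf df am f0 y y0.
have dg (w : R) : w < 0 -> is_derive w 1 (fun y => f y * expR (- m * y))
    (f w * (a w - m) * expR (- m * w)).
  move=> w0; have Hf := is_derive_mul_expR (- m) (df _ w0).
  by apply: (is_derive_eq Hf); ring.
have := is_derive_ge0_ndecrNy dg _ (continuous_mul_expR cf) y0 (lexx 0).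
rewrite mulr0 expR0 mulr1 mulNr expRN ler_pdivrMr ?expR_gt0//; apply.
move=> w w0; apply: mulr_ge0 (expR_ge0 _).
by rewrite mulr_ge0 ?subr_ge0 ?am// ltW// f0// ltW.
Qed.
End LinearODE.

(** * A small ball around the equilibrium *)

Section Basin.
Context {R : realType}.
Variables (n : nat) (lam : R).
Hypothesis n_ge2 : (2 <= n)%N.
Notation r := (Num.sqrt (n%:R : R)).

(** The last two conditions keep [lam * W ^+ 2] and the cross terms of the
   Lyapunov derivative, as well as the drift of the curvature numerator away from
   its value -(sqrt n - 1)^2 at [X = 1], below fixed numerical thresholds. *)
Definition small_radius (rho : R) : Prop :=
  [/\ 0 < rho, rho <= 1 / 60, rho * (1 + n%:R) <= 1 / 20
    & `|lam| * rho * (r + 2) <= 1 / 40].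

Lemma sqr_sqrtn : r ^+ 2 = n%:R.
Proof. by rewrite sqr_sqrtr. Qed.

(** 7/5 is a rational lower bound of sqrt 2. *)
Lemma sqrtn_ge : 7 / 5 <= r.
Proof.
have n2 : 2 <= n%:R :> R by rewrite ler_nat.
have := sqr_sqrtn; have := sqrtr_ge0 (n%:R : R); nra.
Qed.

Lemma sqrtnV_gt0 : 0 < r^-1.
Proof. by rewrite invr_gt0; have := sqrtn_ge; lra. Qed.

Lemma sqrtnV_le : r^-1 <= 5 / 7.
Proof.
have r1 := sqrtn_ge; have e0 := sqrtnV_gt0.
have re : r * r^-1 = 1 by rewrite divff//; lra.
by nra.
Qed.

Lemma small_radius_ex : exists rho, small_radius rho.
Proof.
have r1 := sqrtn_ge; have n2 : 2 <= n%:R :> R by rewrite ler_nat.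
have L0 := normr_ge0 lam.
have LR : 0 <= `|lam| * (r + 2) by rewrite mulr_ge0//; lra.
pose D := 20 * (1 + n%:R + 2 * `|lam| * (r + 2)).
have D0 : 0 < D by rewrite /D; nra.
have DE : D^-1 * (20 * (1 + n%:R + 2 * `|lam| * (r + 2))) = 1.
  by rewrite mulVf// lt0r_neq0.
exists D^-1; have {}D0 : 0 < D^-1 by rewrite invr_gt0.
move: D^-1 D0 DE => rho rho0 rhoE.
have H : 0 <= rho * (`|lam| * (r + 2)) by rewrite mulr_ge0// ltW.
by split => //; nra.
Qed.

Section Ball.
Variables rho W X Y : R.
Hypothesis rho_small : small_radius rho.
Hypothesis in_ball : (X - 1) ^+ 2 + W ^+ 2 + Y ^+ 2 <= rho ^+ 2.

Lemma ball_X_near1 : - rho <= X - 1 <= rho.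
Proof.
case: rho_small => /ltW rad0 _ _ _.
rewrite -ler_norml -(ler_pXn2r (n := 2)) ?nnegrE ?rad0// real_normK ?num_real//.
by have := sqr_ge0 W; have := sqr_ge0 Y; have := in_ball; lra.
Qed.

Lemma ball_lamW_small : - (1 / 60) <= lam * W ^+ 2 <= 1 / 60.
Proof.
have [rad0 rad60 _ H] := rho_small; have r1 := sqrtn_ge.
have L0 := normr_ge0 lam; rewrite -ler_norml normrM [`|W ^+ 2|]ger0_norm ?sqr_ge0//.
have W2 : W ^+ 2 <= rho ^+ 2.
  by have := sqr_ge0 (X - 1); have := sqr_ge0 Y; have := in_ball; lra.
have H1 : `|lam| * W ^+ 2 <= `|lam| * rho ^+ 2 by rewrite ler_wpM2l.
have H2 : 0 <= `|lam| * rho by rewrite mulr_ge0// ltW.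
have H3 : `|lam| * rho <= 1 / 40 by nra.
have H4 : `|lam| * rho * rho <= 1 / 40 * rho.
  by rewrite ler_wpM2r// ltW.
by apply: (le_trans H1); rewrite expr2 mulrA; apply: (le_trans H4); lra.
Qed.

(** The logarithmic derivative of W along the flow; its lower bound makes W decay
   as y -> -oo. *)
Lemma ball_growthW : 1 / 2 <= X ^+ 2 - lam * W ^+ 2 <= 2.
Proof.
have [rad0 rad60 _ _] := rho_small.
by case/andP: ball_X_near1 => ? ?; case/andP: ball_lamW_small => ? ?; nra.
Qed.

Lemma ball_growthY : X ^+ 2 - X / r - lam * W ^+ 2 <= 2.
Proof.
have e0 := sqrtnV_gt0; have [rad0 rad60 _ _] := rho_small.
case/andP: ball_X_near1 => ? ?; case/andP: ball_lamW_small => ? ?.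
have : 0 <= X / r by rewrite mulr_ge0 ?(ltW e0)//; lra.
by nra.
Qed.

(** The right-hand side is half the derivative of V along the flow.  It is a
   combination of (X - 1)^2, W^2 and Y^2 whose coefficients are close to their
   values 2, 1 and 1 - 1 / sqrt n at the equilibrium, all positive. *)
Lemma ball_lyapunov :
  0 <= (X - 1) * (X ^+ 3 - X + Y ^+ 2 / r + lam * (r - X) * W ^+ 2)
    + W * (W * (X ^+ 2 - lam * W ^+ 2))
    + Y * (Y * (X ^+ 2 - X / r - lam * W ^+ 2)).
Proof.
have [rad0 rad60 _ H] := rho_small; have r1 := sqrtn_ge.
have e0 := sqrtnV_gt0; have e1 := sqrtnV_le.
have L0 := normr_ge0 lam.
case/andP: (ball_X_near1) => Z1 Z2; case/andP: ball_lamW_small => k1 k2.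
rewrite (_ : _ + _ = (X * (X + 1)) * (X - 1) ^+ 2
  + (X ^+ 2 - lam * W ^+ 2 + lam * ((X - 1) * (r - X))) * W ^+ 2
  + (X * (X - r^-1) - lam * W ^+ 2 + (X - 1) * r^-1) * Y ^+ 2); last by ring.
have X1 : 0 <= X * (X + 1) by nra.
have c1 : - (1 / 40) <= lam * ((X - 1) * (r - X)).
  rewrite lerNl; apply: le_trans H; apply: le_trans (ler_norm _) _.
  rewrite normrN !normrM -mulrA ler_wpM2l//.
  apply: ler_pM => //; first by rewrite ler_norml Z1 Z2.
  by rewrite ler_norml; apply/andP; split; lra.
have c2 : 0 <= X * (X - r^-1) - lam * W ^+ 2 + (X - 1) * r^-1 by nra.
have c3 : 0 <= X ^+ 2 - lam * W ^+ 2 + lam * ((X - 1) * (r - X)) by nra.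
by rewrite !addr_ge0// mulr_ge0// sqr_ge0.
Qed.

(** The left-hand side is - X ((sqrt n - 1)^2 + (n + 1) (X - 1)), where
   (sqrt n - 1)^2 >= 4/25. *)
Lemma ball_curvature : 2 * r * X - (n%:R + 1) * X ^+ 2 <= - (1 / 10).
Proof.
have [rad0 rad60 H _] := rho_small; have r1 := sqrtn_ge; have r2 := sqr_sqrtn.
case/andP: (ball_X_near1) => Z1 Z2.
have n2 : 2 <= n%:R :> R by rewrite ler_nat.
have c : 11 / 100 <= (n%:R + 1) * X - 2 * r by nra.
by nra.
Qed.

End Ball.
End Basin.

(** * Trajectories stay near the equilibrium *)

Lemma closed_sup_mem {R : realType} (S : set R) : closed S -> has_sup S -> S (sup S).
Proof.
move=> cS supS; suff : closure S (sup S) by rewrite -(closure_id S).1.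
move=> B /nbhs_ballP[e /= e0 Be].
have [z Sz lt_z] := sup_adherent e0 supS.
exists z; split => //; apply: Be; rewrite /ball/= ger0_norm ?subr_ge0.
  by rewrite ltrBlDr -ltrBlDl.
by apply: ub_le_sup => //; case: supS.
Qed.

Section Trapping.
Context {R : realType}.
Variables (n : nat) (lam rho : R) (W X Y : R -> R).
Hypothesis n_ge2 : (2 <= n)%N.
Hypothesis rho_small : small_radius n lam rho.
Hypothesis traj : soliton_trajectory n lam W X Y.

Let V y := (X y - 1) ^+ 2 + W y ^+ 2 + Y y ^+ 2.

Let dV (y : R) :=
  2 * ((X y - 1) * (X y ^+ 3 - X y + Y y ^+ 2 / Num.sqrt n%:R
          + lam * (Num.sqrt n%:R - X y) * W y ^+ 2)
    + W y * (W y * (X y ^+ 2 - lam * W y ^+ 2))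
    + Y y * (Y y * (X y ^+ 2 - X y / Num.sqrt n%:R - lam * W y ^+ 2))).

Hypothesis start : V 0 < rho ^+ 2.

Lemma lyapunov_continuous : {within `]-oo, 0], continuous V}.
Proof.
case: traj => cW cX cY _ _ _ _ _.
have cX1 : {within `]-oo, 0], continuous (X - cst 1)}.
  by apply: within_continuousB => //; exact: cst_continuous.
by apply: within_continuousD; [apply: within_continuousD|]; exact: within_continuousM.
Qed.

Lemma lyapunov_derivative (y : R) : y < 0 -> is_derive y 1 V (dV y).
Proof.
move=> y0; case: traj => _ _ _ /(_ _ y0) HW /(_ _ y0) HX /(_ _ y0) HY _ _.
have H1 := is_deriveB HX (is_derive_cst (1 : R) y 1).
have H2 := is_deriveD (is_deriveD (is_deriveX 2 H1) (is_deriveX 2 HW)) (is_deriveX 2 HY).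
apply: (is_derive_eq H2).
by rewrite /dV !fctE/= /GRing.scale/=; ring.
Qed.

(** Otherwise there is a last time s < 0 with V(s) >= rho^2.  After s the trajectory
   is in the ball, where V is nondecreasing, so V(0) >= V(s) >= rho^2, against the
   choice of the starting point. *)
Lemma trapped (y : R) : y <= 0 -> V y <= rho ^+ 2.
Proof.
move=> y0; rewrite leNgt; apply/negP => Vy.
pose S := [set z : R | z <= 0 /\ rho ^+ 2 <= V z].
have Sy : S y by split => //; exact: ltW.
have supS : has_sup S by split; [exists y|exists 0 => z []].
have [s0 Vs] : S (sup S).
  apply: closed_sup_mem => //.
  have := (continuous_closedP (V : subspace `]-oo, 0] -> R)).1 lyapunov_continuous _
    (@closed_ge R (rho ^+ 2)).
  move=> /closed_subspaceP[K cK KE].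
  rewrite (_ : S = K `&` `]-oo, 0]); first exact: closedI.
  rewrite KE; apply/seteqP; split => z /=; by rewrite in_itv/=; case.
have s_lt0 : sup S < 0.
  rewrite lt_neqAle s0 andbT; apply: contraTneq start => <-.
  by rewrite -leNgt.
have cV : {within `[sup S, 0], continuous V}.
  by apply: continuous_subspaceW lyapunov_continuous; exact: subset_itvr.
have dVz (z : R) : z \in `]sup S, 0[ -> is_derive z 1 V (dV z).
  by rewrite in_itv/= => /andP[_ z0]; exact: lyapunov_derivative z0.
have [c] := MVT s_lt0 dVz cV.
rewrite in_itv/= => /andP[sc c0] Vsc.
have Vc : V c <= rho ^+ 2.
  rewrite leNgt; apply/negP => /ltW Vc.
  have : c <= sup S by apply: ub_le_sup; [case: supS|split => //; exact: ltW].
  by rewrite leNgt sc.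
have := ball_lyapunov n_ge2 rho_small Vc => H.
have : 0 <= V 0 - V (sup S).
  by rewrite Vsc mulr_ge0 ?subr_ge0// mulr_ge0.
by rewrite subr_ge0 => /(le_trans Vs); rewrite leNgt start.
Qed.
End Trapping.

(** * The arclength *)

Section Arclength.
Context {R : realType}.
Notation mu := (@lebesgue_measure R).

Lemma integral_expR_Ny (m b : R) : 0 < m ->
  (\int[mu]_(t in `]-oo, b]) (expR (m * t))%:E)%E = (expR (m * b) / m)%:E.
Proof.
move=> m0; have cE : continuous (fun t : R => expR (m * t)).
  by move=> t; apply: continuous_comp; [exact: mulrl_continuous|exact: continuous_expR].
rewrite -[b]opprK ge0_integration_by_substitutionNy; last 2 first.
- exact: continuous_subspaceT.
- by move=> t _; exact: expR_ge0.
pose F (t : R) := - (expR (m * - t) / m).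
have dF (t : R) : is_derive t 1 F (expR (m * - t)).
  have H1 : is_derive t 1 (fun t => m * - t) (- m).
    by apply: is_derive_eq; rewrite /GRing.scale/= mulrN1.
  have H2 := @is_derive1_comp _ expR (fun t => m * - t) t _ _ (is_derive_expR _) H1.
  have H3 := is_deriveN (is_deriveZ m^-1 H2).
  have -> : F = - (m^-1 \*: (expR \o (fun t => m * - t))).
    by apply/funext => z; rewrite /F !fctE/= mulrC.
  by apply: (is_derive_eq H3); rewrite /GRing.scale/=; field; rewrite gt_eqF.
rewrite (@ge0_continuous_FTC2y _ _ F _ 0).
- by rewrite /F opprK add0e -EFinN opprK.
- by move=> t _; exact: expR_ge0.
- apply: continuous_subspaceT => t.
  by apply: (@continuous_comp _ _ _ -%R (fun t => expR (m * t))); [exact: opp_continuous|exact: cE].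
- rewrite -oppr0 -(mul0r m^-1); apply: cvgN; apply: cvgMr_tmp.
  under eq_fun do rewrite mulrN.
  exact: (cvg_comp _ _ (gt0_cvgMry m0 cvg_id) (@cvgr_expR R)).
- by move=> t _; have [] := dF t.
- apply: cvg_at_right_filter.
  apply: differentiable_continuous; apply/derivable1_diffP.
  by have [] := dF (- b).
- by move=> t _; rewrite derive1E; have H := dF t; rewrite derive_val.
Qed.

Variables (W : R -> R) (m C : R).
Hypothesis cW : {within `]-oo, 0], continuous W}.
Hypothesis W_gt0 : forall y : R, y <= 0 -> 0 < W y.
Hypothesis m_gt0 : 0 < m.
Hypothesis W_le : forall y : R, y <= 0 -> W y <= C * expR (m * y).

Lemma expR_integrable (b : R) :
  mu.-integrable `]-oo, b] (EFin \o (fun y => expR (m * y))).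
Proof.
have cE : continuous (fun t : R => expR (m * t)).
  by move=> t; apply: continuous_comp; [exact: mulrl_continuous|exact: continuous_expR].
apply/integrableP; split.
  by apply/measurable_EFinP; apply: measurable_funTS; exact: continuous_measurable_fun.
under eq_integral do rewrite /= ger0_norm ?expR_ge0//.
by rewrite integral_expR_Ny// ltry.
Qed.

Lemma scaled_expR_integrable (b : R) :
  mu.-integrable `]-oo, b] (EFin \o (fun y => C * expR (m * y))).
Proof. by apply: (integrableZl _ C (expR_integrable b)). Qed.

Lemma W_integrable : mu.-integrable `]-oo, 0] (EFin \o W).
Proof.
apply: (le_integrable _ _ _ (scaled_expR_integrable 0)) => //.
  apply/measurable_EFinP; exact: subspace_continuous_measurable_fun.
move=> y /=; rewrite in_itv/= => y0.
by rewrite lee_fin ger0_norm ?(ltW (W_gt0 _))// (le_trans (W_le y0))// ler_norm.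
Qed.

Lemma is_derive_arclength (y : R) : y < 0 -> is_derive y 1 (arclength W) (W y).
Proof.
move=> y0; have cWy : {for y, continuous W}.
  by have /continuous_within_itvNycP[H _] := cW; apply: H; rewrite in_itv/=.
have [H1 H2] := continuous_FTC1 y0 W_integrable (ltNyr _) cWy.
by split; [exact: H1|rewrite -H2 derive1E].
Qed.

Lemma arclength_ge0 (y : R) : y <= 0 -> 0 <= arclength W y.
Proof.
move=> y0; apply: Rintegral_ge0 => t; rewrite /= in_itv/= => ty.
by rewrite ltW// W_gt0// (le_trans ty).
Qed.

Lemma arclength_le (y : R) : y <= 0 -> arclength W y <= C * (expR (m * y) / m).
Proof.
move=> y0; have sub : `]-oo, y] `<=` `]-oo, 0] by exact: subset_itvl.
have -> : C * (expR (m * y) / m) = \int[mu]_(t in `]-oo, y]) (C * expR (m * t)).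
  rewrite RintegralZl//; last exact: expR_integrable.
  by congr (_ * _); rewrite /Rintegral (integral_expR_Ny y m_gt0).
apply: le_Rintegral => //.
- exact: integrableS W_integrable.
- exact: scaled_expR_integrable.
- move=> t; rewrite /= in_itv/= => ty.
  by rewrite W_le// (le_trans ty).
Qed.

Lemma arclength_ltr (y z : R) : y < z -> z < 0 -> arclength W y < arclength W z.
Proof.
move=> yz z0.
have dL (t : R) : t \in `]y, z[ -> is_derive t 1 (arclength W) (W t).
  by rewrite in_itv/= => /andP[_ tz]; apply: is_derive_arclength; exact: lt_trans z0.
have cL : {within `[y, z], continuous (arclength W)}.
  apply: derivable_within_continuous => t; rewrite in_itv/= => /andP[_ tz].
  by have [] := is_derive_arclength (le_lt_trans tz z0).
have [c] := MVT yz dL cL; rewrite in_itv/= => /andP[_ cz] E.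
by rewrite -subr_gt0 E mulr_gt0 ?subr_gt0// W_gt0// ltW// (lt_trans cz).
Qed.

Lemma arclength_gt0 (y : R) : y < 0 -> 0 < arclength W y.
Proof.
move=> y0; apply: (@le_lt_trans _ _ (arclength W (y - 1))).
  by apply: arclength_ge0; lra.
by apply: arclength_ltr => //; lra.
Qed.

Lemma arclength_surj (y0 x : R) : y0 < 0 -> 0 < x < arclength W y0 ->
  exists2 y, y < y0 & arclength W y = x.
Proof.
move=> y00 /andP[x0 xL].
have C0 : 0 < C.
  have := W_le (lexx 0); rewrite mulr0 expR0 mulr1.
  by apply: lt_le_trans; exact: W_gt0.
(* [arclength_le] bounds the arclength by C e^(m y) / m; at any y <= ln e / m this
   is at most x / 2. *)
pose e := x * m / (2 * C).
have e0 : 0 < e by rewrite divr_gt0 ?mulr_gt0.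
pose y1 := Num.min (y0 - 1) (ln e / m).
have y10 : y1 < y0 by rewrite gt_min; apply/orP; left; lra.
have Ly1 : arclength W y1 < x.
  have y1e : expR (m * y1) <= e.
    rewrite -[leRHS]lnK ?posrE// ler_expR mulrC -ler_pdivlMr//.
    by rewrite ge_min lexx orbT.
  have y1N : y1 <= 0 by rewrite ltW// (lt_trans y10).
  apply: (le_lt_trans (arclength_le y1N)); rewrite -ltr_pdivlMl//.
  rewrite ltr_pdivrMr//; apply: (le_lt_trans y1e).
  have -> : C^-1 * x * m = e * 2 by rewrite /e; field; rewrite gt_eqF.
  by lra.
have cL : {within `[y1, y0], continuous (arclength W)}.
  apply: derivable_within_continuous => t; rewrite in_itv/= => /andP[_ ty].
  by have [] := is_derive_arclength (le_lt_trans ty y00).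
have [|c + Lc] := IVT (ltW y10) cL (v := x).
  by rewrite ge_min le_max (ltW Ly1) (ltW xL) orbT.
rewrite in_itv/= => /andP[_ cy]; exists c => //.
rewrite lt_neqAle cy andbT; apply: contraTneq xL => <-.
by rewrite Lc ltxx.
Qed.

(** The inverse of the arclength on the negative half-line, where it is strictly
   increasing, extended by 0 outside the range. *)
Definition arclength_inv (x : R) : R := xget 0 [set y | y < 0 /\ arclength W y = x].

Lemma arclength_inj (y z : R) : y < 0 -> z < 0 ->
  arclength W y = arclength W z -> y = z.
Proof.
move=> y0 z0 E; have [yz|zy|//] := ltgtP y z.
  by have := arclength_ltr yz z0; rewrite E ltxx.
by have := arclength_ltr zy y0; rewrite E ltxx.
Qed.

Lemma arclength_invK (y : R) : y < 0 -> arclength_inv (arclength W y) = y.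
Proof.
move=> y0; rewrite /arclength_inv; case: xgetP => [z _ [z0 /arclength_inj]|/(_ y)[]//].
exact.
Qed.

Lemma is_derive_arclength_inv (y : R) : y < 0 ->
  is_derive (arclength W y) 1 arclength_inv (W y)^-1.
Proof.
move=> y0; apply: is_derive_inverse.
- by near=> z; apply: arclength_invK; near: z; exact: lt_nbhsl.
- near=> z; apply: differentiable_continuous; apply/derivable1_diffP.
  have z0 : z < 0 by near: z; exact: lt_nbhsl.
  by have [] := is_derive_arclength z0.
- exact: is_derive_arclength.
- by rewrite gt_eqF// W_gt0// ltW.
Unshelve. all: by end_near. Qed.

End Arclength.

(** * Curvature of the solitons *)

Section SolitonCurvature.
Context {R : realType}.
Variables (n : nat) (lam rho : R) (W X Y psi : R -> R).
Hypothesis n_ge2 : (2 <= n)%N.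
Hypothesis rho_small : small_radius n lam rho.
Hypothesis traj : soliton_trajectory n lam W X Y.
Hypothesis start : (X 0 - 1) ^+ 2 + W 0 ^+ 2 + Y 0 ^+ 2 < rho ^+ 2.
Notation r := (Num.sqrt (n%:R : R)).
Hypothesis psiE : forall y : R, y <= 0 ->
  psi (arclength W y) = Num.sqrt (n * (n - 1))%:R * W y / Y y.

Lemma soliton_W_gt0 (y : R) : y <= 0 -> 0 < W y.
Proof.
apply: (linear_ode_gt0 (trajectory_contW traj) (trajectory_W traj) (M := 2)); last first.
  exact: trajectory_W0 traj.
move=> z /ltW z0.
by have /andP[] := ball_growthW n_ge2 rho_small (trapped n_ge2 rho_small traj start z0).
Qed.

Lemma soliton_Y_gt0 (y : R) : y <= 0 -> 0 < Y y.
Proof.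
apply: (linear_ode_gt0 (trajectory_contY traj) (trajectory_Y traj) (M := 2)); last first.
  exact: trajectory_Y0 traj.
move=> z /ltW z0.
by have := ball_growthY n_ge2 rho_small (trapped n_ge2 rho_small traj start z0).
Qed.

Lemma soliton_W_le (y : R) : y <= 0 -> W y <= W 0 * expR (1 / 2 * y).
Proof.
apply: (linear_ode_decay (trajectory_contW traj) (trajectory_W traj)).
  move=> z /ltW z0.
  by have /andP[] := ball_growthW n_ge2 rho_small (trapped n_ge2 rho_small traj start z0).
exact: soliton_W_gt0.
Qed.

Let half_gt0 : 0 < 1 / 2 :> R. Proof. by rewrite divr_gt0. Qed.

Let surj := arclength_surj (trajectory_contW traj) soliton_W_gt0 half_gt0 soliton_W_le.
Let yK := arclength_invK (trajectory_contW traj) soliton_W_gt0 half_gt0 soliton_W_le.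
Let L_gt0 := arclength_gt0 (trajectory_contW traj) soliton_W_gt0 half_gt0 soliton_W_le.
Let L_lt := arclength_ltr (trajectory_contW traj) soliton_W_gt0 half_gt0 soliton_W_le.
Let dy := is_derive_arclength_inv (trajectory_contW traj) soliton_W_gt0 half_gt0 soliton_W_le.

(** psi' / psi as a function of the arclength. *)
Definition log_slope (x : R) : R := X (arclength_inv W x) / (r * W (arclength_inv W x)).

(** Properties along the trajectory are local properties in the arclength, because
   the image of the negative half-line is open. *)
Lemma near_arclength (P : R -> Prop) (z : R) : z < 0 ->
  (forall y : R, y < 0 -> P (arclength W y)) -> \forall x \near arclength W z, P x.
Proof.
move=> z0 HP; have z2 : z < z / 2 by lra.
have z20 : z / 2 < 0 by lra.
apply: (@filterS _ _ _ [set x | 0 < x < arclength W (z / 2)]) => [x /(surj z20)[y yz <-]|].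
  by apply: HP; exact: lt_trans z20.
have Lz := L_lt z2 z20; have L0 := L_gt0 z0.
near=> x; apply/andP; split; near: x; [exact: lt_nbhsr|exact: lt_nbhsl].
Unshelve. all: by end_near. Qed.

Lemma profile_neq0 (y : R) : y < 0 -> psi (arclength W y) != 0.
Proof.
move=> /ltW y0; rewrite psiE// !mulf_neq0 ?invr_eq0 ?gt_eqF ?soliton_W_gt0 ?soliton_Y_gt0//.
by rewrite sqrtr_gt0 ltr0n muln_gt0 subn_gt0 (ltnW n_ge2).
Qed.

(** psi is the quotient W / Y, up to a constant, as a function of the arclength;
   lam and X^2 cancel between the logarithmic derivatives of W and Y. *)
Lemma is_derive_profile (z : R) : z < 0 ->
  is_derive (arclength W z) 1 psi (psi (arclength W z) * log_slope (arclength W z)).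
Proof.
move=> z0; set c := Num.sqrt ((n * (n - 1))%:R : R).
have W0 := lt0r_neq0 (soliton_W_gt0 (ltW z0)); have Y0 := lt0r_neq0 (soliton_Y_gt0 (ltW z0)).
have r0 : r != 0 by rewrite lt0r_neq0//; have := sqrtn_ge (R := R) n_ge2; lra.
have dW := trajectory_W traj z0; have dY := trajectory_Y traj z0.
have dWY := is_deriveZ c (is_deriveM dW (is_deriveV Y0 dY)).
have yz : arclength_inv W (arclength W z) = z by exact: yK.
rewrite -{1}yz in dWY.
have dpsi := is_derive1_comp dWY (dy z0).
have E : \forall x \near arclength W z,
    (c \*: (W * (fun y => (Y y)^-1)) \o arclength_inv W) x = psi x.
  by apply: near_arclength => // y y0; rewrite /= !fctE yK// psiE ?(ltW y0)// /GRing.scale/= mulrA.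
apply: (is_derive_eq (near_eq_is_derive E dpsi)).
rewrite /log_slope yz psiE ?(ltW z0)// -/c /GRing.scale/=; field.
by rewrite W0 Y0 r0.
Qed.

(** In (X / W)_y the cubic terms of X_y and X W_y / W cancel, which leaves
   (- X + Y^2 / r + lam r W^2) / W. *)
Lemma is_derive_log_slope (z : R) : z < 0 ->
  is_derive (arclength W z) 1 log_slope
    ((Y z ^+ 2 / r - X z + lam * r * W z ^+ 2) / (r * W z ^+ 2)).
Proof.
move=> z0.
have W0 := lt0r_neq0 (soliton_W_gt0 (ltW z0)).
have r0 : r != 0 by rewrite lt0r_neq0//; have := sqrtn_ge (R := R) n_ge2; lra.
have rW0 : (r \*: W) z != 0 by rewrite mulf_neq0.
have dW := trajectory_W traj z0; have dX := trajectory_X traj z0.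
have dXW := is_deriveM dX (@is_deriveV _ (r \*: W) _ _ _ rW0 (is_deriveZ r dW)).
have yz : arclength_inv W (arclength W z) = z by exact: yK.
rewrite -{1}yz in dXW.
apply: (is_derive_eq (is_derive1_comp dXW (dy z0))).
rewrite /GRing.scale/= /GRing.scale/=; field.
by rewrite W0 r0.
Qed.

Lemma soliton_scalar_curvature (z : R) (south : bool) (u : 'rV[R]_n) : z < 0 ->
  scalar_curvature (warped_metric psi south) (row_mx (arclength W z)%:M u) =
  (2 * r * X z - (n%:R + 1) * X z ^+ 2 - Y z ^+ 2 - 2 * n%:R * lam * W z ^+ 2)
    / W z ^+ 2.
Proof.
move=> z0; set x := arclength W z; pose p := row_mx x%:M u : 'rV[R]_(1 + n).
have px : p 0 (lshift n ord0) = x by rewrite /p row_mxEl mxE eqxx mulr1n.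
have W0 := lt0r_neq0 (soliton_W_gt0 (ltW z0)); have Y0 := lt0r_neq0 (soliton_Y_gt0 (ltW z0)).
have r0 : r != 0 by rewrite lt0r_neq0//; have := sqrtn_ge (R := R) n_ge2; lra.
have yz : arclength_inv W x = z by exact: yK.
have dpsi : \forall y \near p 0 (lshift n ord0), is_derive (y : R) 1 psi (psi y * log_slope y).
  by rewrite px; apply: near_arclength => // y y0; exact: is_derive_profile.
have psi0 : \forall y \near p 0 (lshift n ord0), psi y != 0.
  by rewrite px; apply: near_arclength => // y y0; exact: profile_neq0.
have dpsi1 := is_deriveM (is_derive_profile z0) (is_derive_log_slope z0).
rewrite -/x -{1}px in dpsi1.
rewrite -/p (scalar_curvature_warped south dpsi psi0 dpsi1) px.
have c2 : Num.sqrt (n * (n - 1))%:R ^+ 2 = r ^+ 2 * (r ^+ 2 - 1) :> R.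
  by rewrite !sqr_sqrtr// natrM natrB// ltnW.
have psix := profile_neq0 z0; rewrite -/x in psix.
have N1 : r ^+ 2 - 1 != 0.
  by rewrite sqr_sqrtr// subr_eq0 pnatr_eq1 gtn_eqF.
have psi2 : psi x ^+ 2 = r ^+ 2 * (r ^+ 2 - 1) * W z ^+ 2 / Y z ^+ 2.
  by rewrite psiE ?(ltW z0)// exprMn exprVn exprMn c2.
rewrite exprMn psi2 /log_slope yz /GRing.scale/=.
move: (sqr_sqrtn (R := R) n) r0 N1; set q := Num.sqrt n%:R => <- r0 N1.
by field; rewrite ?N1 ?W0 ?Y0 ?r0 ?psix.
Qed.

Lemma soliton_scalar_curvature_le (z : R) (south : bool) (u : 'rV[R]_n) : z < 0 ->
  scalar_curvature (warped_metric psi south) (row_mx (arclength W z)%:M u) <=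
  - (10 * W z ^+ 2)^-1 + 2 * n%:R * `|lam|.
Proof.
move=> z0; rewrite soliton_scalar_curvature//.
have W0 := soliton_W_gt0 (ltW z0).
have := ball_curvature n_ge2 rho_small (trapped n_ge2 rho_small traj start (ltW z0)).
have := sqr_ge0 (Y z) => Y2 H.
have n0 : 0 <= n%:R :> R by [].
have E : (10 * W z ^+ 2)^-1 * W z ^+ 2 = 1 / 10 by field; rewrite gt_eqF.
rewrite ler_pdivrMr ?exprn_gt0// [leRHS]mulrDl mulNr E.
have : - (2 * n%:R * lam * W z ^+ 2) <= 2 * n%:R * `|lam| * W z ^+ 2.
  rewrite -mulNr -mulrN; apply: ler_wpM2r (sqr_ge0 _) _ _ _.
  by apply: ler_wpM2l; rewrite ?mulr_ge0// -normrN ler_norm.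
lra.
Qed.

Lemma soliton_scalar_curvature_cvgNy (A : R) : \forall x \near 0^'+,
  forall (south : bool) (u : 'rV[R]_n),
    scalar_curvature (warped_metric psi south) (row_mx x%:M u) < A.
Proof.
pose B := `|A| + 2 * n%:R * `|lam| + 1.
have B1 : 1 <= B by rewrite lerDr addr_ge0// !mulr_ge0.
(* If W <= w, then 10 W^2 <= W <= 1 / B by B >= 1, so 1 / (10 W^2) >= B. *)
pose w := (10 * B)^-1.
have w0 : 0 < w by rewrite invr_gt0; lra.
have wB : w * (10 * B) = 1 by rewrite mulVf// lt0r_neq0//; lra.
have W00 := soliton_W_gt0 (lexx 0).
pose z0 := Num.min (- 1) (2 * ln (w / W 0)).
have z00 : z0 < 0 by rewrite gt_min ltrN10.
have small (z : R) : z < z0 -> W z <= w.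
  move=> /ltW; rewrite le_min => /andP[z1 zl].
  apply: (le_trans (soliton_W_le _)); first by lra.
  rewrite -ler_pdivlMl// [leRHS]mulrC -[leRHS]lnK ?posrE ?divr_gt0// ler_expR.
  by lra.
near=> x => south u.
have [||z zz0 <-] := @surj z0 x.
- by [].
- by apply/andP; split; near: x; [exact: nbhs_right_gt|exact: nbhs_right_lt (L_gt0 z00)].
have z_lt0 := lt_trans zz0 z00.
apply: (le_lt_trans (soliton_scalar_curvature_le south u z_lt0)).
have Wz := small _ zz0; have Wz0 := soliton_W_gt0 (ltW z_lt0).
have : B <= (10 * W z ^+ 2)^-1.
  rewrite -[leLHS]invrK lef_pV2 ?posrE ?invr_gt0 ?mulr_gt0 ?exprn_gt0//; last by lra.
  rewrite -[leRHS]mul1r ler_pdivlMr; last by lra.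
  by nra.
have := ler_norm (- A); rewrite normrN /B => ? ?.
lra.
Unshelve. all: by end_near. Qed.

End SolitonCurvature.

Theorem mainTheorem4 (R : realType) (n : nat) (lam : R) (hn : (2 <= n)%N) :
  exists2 eps : R, 0 < eps &
    forall W X Y psi omega phi : R -> R,
      soliton_trajectory n lam W X Y ->
      `|W 0| < eps -> `|X 0 - 1| < eps -> `|Y 0| < eps ->
      soliton_profile n W X Y psi omega phi ->
      forall A : R, \forall x \near 0^'+,
        forall (south : bool) (u : 'rV[R]_n),
          scalar_curvature (warped_metric psi south) (row_mx x%:M u) < A.
Proof.
have [rho rho_small] := small_radius_ex lam hn.
have [rho0 _ _ _] := rho_small.
exists (rho / 2); first by rewrite divr_gt0.
move=> W X Y psi omega phi traj W0 X0 Y0 [psiE _ _].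
apply: (soliton_scalar_curvature_cvgNy hn rho_small traj) => //.
have sq (a : R) : `|a| < rho / 2 -> a ^+ 2 < rho ^+ 2 / 4.
  by rewrite ltr_norml => /andP[? ?]; nra.
by have := sq _ W0; have := sq _ X0; have := sq _ Y0; nra.
Qed.
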